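(* Let $u,\varphi\in AC_g([a,b])$. Then $$u(b)\varphi(b)-u(a)\varphi(a)=\int_{[a,b)}u\,D_g\varphi\,d\mu_g+\int_{[a,b)}D_gu\,S_g\varphi\,d\mu_g .$$ Equivalently, $$u(b)\varphi(b)-u(a)\varphi(a)=\int_{[a,b)}S_gu\,D_g\varphi\,d\mu_g+\int_{[a,b)}D_gu\,\varphi\,d\mu_g .$$
   Context: Let $\mathbb F$ be $\mathbb R$ or $\mathbb C$, let $a<b$ be real, and let $g:[a,b]\to\mathbb R$ be nondecreasing and left-continuous. $\mu_g$ is the finite Lebesgue--Stieltjes measure on $[a,b)$ with $\mu_g([s,t))=g(t)-g(s)$ for $a\le s\le t\le b$. Standing assumption: $M_g:=\mu_g([a,b))=g(b)-g(a)>0$. For $1\le p\le\infty$, $L_g^p([a,b))$ is the $L^p$ space of $\mathbb F$-valued functions for the completion of $\mu_g$ (modulo $\mu_g$-a.e. equality). $J_g:=\{t\in[a,b):\Delta g(t):=g(t^+)-g(t)>0\}$ is the set of jump points, so $\mu_g(\{t\})=\Delta g(t)$ for $t\in J_g$. $AC_g([a,b])$ is the set of $u:[a,b]\to\mathbb F$ such that for every $\varepsilon>0$ there is $\delta>0$ such that, for every finite family of pairwise disjoint intervals $[a_j,b_j)\subset[a,b)$, $\sum_j(g(b_j)-g(a_j))<\delta$ implies $\sum_j|u(b_j)-u(a_j)|<\varepsilon$. It is known that $u\in AC_g([a,b])$ if and only if there is $v\in L_g^1([a,b))$ with $u(t)=u(a)+\int_{[a,t)}v\,d\mu_g$ for all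 $t\in[a,b]$; $v$ is unique $\mu_g$-a.e. and the Stieltjes derivative is $D_gu:=v$. Posterior trace: for $u\in AC_g([a,b])$, $S_gu(t):=u(t^+)$ if $t\in J_g$ and $S_gu(t):=u(t)$ if $t\notin J_g$. *)

(* Defs.v *)
From HB Require Import structures.
From mathcomp Require Import all_boot all_order all_algebra.
From mathcomp Require Import complex.
From mathcomp Require Import all_classical all_reals all_analysis.
From mathcomp Require Import measurable_realfun.

Set Implicit Arguments.
Unset Strict Implicit.
Unset Printing Implicit Defensive.

Import Order.TTheory GRing.Theory Num.Theory.
Import numFieldNormedType.Exports.

Local Open Scope classical_set_scope.
Local Open Scope ring_scope.

(* Functions on [a, b] are total functions on R of which only the values on
   [a, b] are ever used. *)
Record derivator (R : realType) (a b : R) := Derivator {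
  derivator_fun :> R -> R ;
  derivator_lt : a < b ;
  derivator_nd : {in `[a, b] &, {homo derivator_fun : x y / x <= y}} ;
  derivator_lc : {in `]a, b], forall t,
    derivator_fun x @[x --> t^'-] --> derivator_fun t} }.

(* The library builds Lebesgue-Stieltjes measures from right-continuous
   functions f, with mass f t - f s on ]s, t]. A left-continuous g, extended to
   R by the constants g a and g b, is therefore reflected into
   f x := - g (- x), and the measure of f is pushed forward by x |-> - x. *)
Section stieltjes_measure.
Context (R : realType) (a b : R) (g : derivator a b).

Definition reflected (x : R) : R := - g (Num.max a (Num.min (- x) b)).

Let clamp_in (x : R) : Num.max a (Num.min x b) \in `[a, b].
Proof.
have ab := ltW (derivator_lt g).
by rewrite in_itv/= le_max lexx/= ge_max ab ge_min lexx orbT.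
Qed.

Lemma reflected_nd : nondecreasing reflected.
Proof.
move=> x y xy; rewrite /reflected lerN2; apply: (derivator_nd g) => //.
rewrite ge_max le_max lexx/= le_max; apply/orP; right.
by rewrite le_min !ge_min lerN2 xy/= lexx orbT.
Qed.

Lemma reflected_rc : right_continuous reflected.
Proof.
move=> x; have ab := derivator_lt g; rewrite /reflected.
apply: cvgN; have [xa|xa] := leP (- x) a.
  have -> : Num.max a (Num.min (- x) b) = a.
    by apply/max_idPl; rewrite ge_min xa.
  apply: cvg_near_cst; near=> y.
  rewrite (_ : Num.max _ _ = a)//; apply/max_idPl; rewrite ge_min.
  apply/orP; left; apply: le_trans xa; rewrite lerN2.
  by near: y; exact: nbhs_right_ge.
have [xb|xb] := leP (- x) b; last first.
  have /max_idPr -> : a <= b by exact: ltW.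
  apply: cvg_near_cst; near=> y.
  have /min_idPr -> : b <= - y.
    rewrite lerNr; near: y; apply: nbhs_right_le; by rewrite ltrNr.
  by have /max_idPr -> : a <= b by exact: ltW.
have /max_idPr -> : a <= - x by exact: ltW.
have := @derivator_lc _ _ _ g (- x).
rewrite in_itv/= xa xb => /(_ isT) => gx.
have : g (- y) @[y --> x^'+] --> g (- x).
  by move/cvg_at_leftNP: gx; rewrite opprK.
apply: cvg_trans; apply: near_eq_cvg; near=> y.
have xy : x <= y by near: y; exact: nbhs_right_ge.
have /min_idPl -> : - y <= b by rewrite (le_trans _ xb)// lerN2.
have /max_idPr -> // : a <= - y.
rewrite lerNr; near: y; apply: nbhs_right_le; by rewrite ltrNr.
Unshelve. all: by end_near. Qed.

HB.instance Definition _ :=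
  isCumulative.Build R _ R reflected reflected_nd reflected_rc.


Definition borel_stieltjes : set (measurableTypeR R) -> \bar R :=
  pushforward (lebesgue_stieltjes_measure reflected) -%R.

Let measurable_opp : measurable_fun [set: measurableTypeR R]
  (-%R : measurableTypeR R -> measurableTypeR R).
Proof. exact: oppr_measurable. Qed.

Let borel_stieltjes0 : borel_stieltjes set0 = 0%E.
Proof. by rewrite /borel_stieltjes /pushforward preimage_set0 measure0. Qed.

Let borel_stieltjes_ge0 A : (0 <= borel_stieltjes A)%E.
Proof. exact: measure_ge0. Qed.

Let borel_stieltjes_sigma_additive : semi_sigma_additive borel_stieltjes.
Proof.
move=> A mA tA mUA; rewrite /borel_stieltjes /pushforward preimage_bigcup.
apply: measure_semi_sigma_additive.
- by move=> n; rewrite -[X in measurable X]setTI; exact: measurable_opp.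
- apply/trivIsetP => /= m n _ _ mn; rewrite -preimage_setI.
  by move/trivIsetP : tA => /(_ _ _ _ _ mn) ->//; rewrite preimage_set0.
- rewrite -preimage_bigcup -[X in measurable X]setTI.
  exact: measurable_opp.
Qed.

HB.instance Definition _ := isMeasure.Build _ _ _ borel_stieltjes
  borel_stieltjes0 borel_stieltjes_ge0 borel_stieltjes_sigma_additive.

Definition stieltjes := @completed_measure_extension _ _ _ borel_stieltjes.

HB.instance Definition _ := Measure.on stieltjes.

Lemma borel_stieltjes_itv (s t : R) : a <= s -> s <= t -> t <= b ->
  borel_stieltjes `[s, t[ = (g t - g s)%:E.
Proof.
move=> as_ st tb; rewrite /borel_stieltjes /pushforward.
have -> : -%R @^-1` `[s, t[ = `]- t, - s]%classic.
  apply/seteqP; split=> x /=; rewrite !in_itv/= => /andP[xs xt];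
  by rewrite lerNr ltrNl ?xs ?xt// -?lerNr -?ltrNl; apply/andP.
rewrite /lebesgue_stieltjes_measure /measure_extension measurable_mu_extE/=;
  last exact: is_ocitv.
rewrite wlength_itv_bnd ?lerN2//= /reflected !opprK.
have /min_idPl -> : s <= b by exact: le_trans tb.
have /min_idPl -> : t <= b by [].
have /max_idPr -> : a <= s by [].
have /max_idPr -> : a <= t by exact: le_trans st.
by rewrite addrC.
Qed.

Lemma stieltjes_itv (s t : R) : a <= s -> s <= t -> t <= b ->
  stieltjes `[s, t[ = (g t - g s)%:E.
Proof.
move=> as_ st tb; rewrite -borel_stieltjes_itv//.
by rewrite /stieltjes /completed_measure_extension measurable_mu_extE.
Qed.

End stieltjes_measure.

Arguments stieltjes {R a b} g.

Variant scalar_kind := RealScalars | ComplexScalars.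

Definition scalar_field (R : realType) (k : scalar_kind) : numFieldType :=
  match k with RealScalars => R | ComplexScalars => R[i] end.

Section stieltjes_calculus.
Context (R : realType) (a b : R) (g : derivator a b) (k : scalar_kind).
Local Notation F := (scalar_field R k).
Implicit Types D : set R.

Definition stieltjes_integrable D : (R -> F) -> Prop :=
  match k return (R -> scalar_field R k) -> Prop with
  | RealScalars => fun v => (stieltjes g).-integrable D (EFin \o v)
  | ComplexScalars => fun v =>
      (stieltjes g).-integrable D (EFin \o (fun t => complex.Re (v t))) /\
      (stieltjes g).-integrable D (EFin \o (fun t => complex.Im (v t)))
  end.

Definition stieltjes_integral D : (R -> F) -> F :=
  match k return (R -> scalar_field R k) -> scalar_field R k with
  | RealScalars => fun v => \int[stieltjes g]_(t in D) v t
  | ComplexScalars => fun v =>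
      Complex (\int[stieltjes g]_(t in D) complex.Re (v t))
              (\int[stieltjes g]_(t in D) complex.Im (v t))
  end.

(* The norm of F takes its values in F itself; for F = R[i], 0 < eps means that
   eps is real and positive. *)
Definition stieltjes_AC (u : R -> F) := forall eps : F, 0 < eps ->
  exists2 delta : R, 0 < delta &
    forall (n : nat) (s t : 'I_n -> R),
      (forall j, a <= s j /\ s j < t j /\ t j <= b) ->
      trivIset setT (fun j => `[s j, t j[%classic) ->
      \sum_(j < n) (g (t j) - g (s j)) < delta ->
      \sum_(j < n) `|u (t j) - u (s j)| < eps.

(* v is a representative of the Stieltjes derivative D_g u, which is a class
   modulo equality almost everywhere. *)
Definition is_stieltjes_derivative (u v : R -> F) :=
  stieltjes_integrable `[a, b[%classic v /\
  {in `[a, b], forall t, u t = u a + stieltjes_integral `[a, t[%classic v}.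

Definition jump_point (t : R) : Prop :=
  a <= t < b /\ 0 < lim (g x @[x --> t^'+]) - g t.

Definition posterior_trace (u : R -> F) (t : R) : F :=
  if `[< jump_point t >] then lim (u x @[x --> t^'+]) else u t.

End stieltjes_calculus.

(* Main.v *)
(* Replacing u and phi by their integral representations, the first formula says
   that the square [a, b[ x [a, b[ splits into the part s < t, which Fubini's
   theorem turns into the integral of u D_g phi, and the part t <= s, which
   yields D_g u against phi(a) + int_[a, s] D_g phi. The latter function is the
   posterior trace of phi at every point: by dominated convergence it is the
   right limit of phi, and at a point s that is not a jump point {s} is null, so
   that it is phi(s). The second formula is the first one with u and phi
   exchanged. *)
Require Import Defs.
From HB Require Import structures.
From mathcomp Require Import all_boot all_order all_algebra.
From mathcomp Require Import complex.
From mathcomp Require Import all_classical all_reals all_analysis.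
From mathcomp Require Import measurable_realfun ring lra.

Set Implicit Arguments.
Unset Strict Implicit.
Unset Printing Implicit Defensive.

Import Order.TTheory GRing.Theory Num.Theory.
Import numFieldNormedType.Exports.

Local Open Scope classical_set_scope.
Local Open Scope ring_scope.

(** * Fubini's theorem for products of integrable functions cut by a measurable set *)

Section fubini_Rintegral.
Context d (T : measurableType d) (R : realType).
Variable mu : {sigma_finite_measure set T -> \bar R}.
Variables (f h : T -> R) (A : set (T * T)).
Hypotheses (fi : mu.-integrable setT (EFin \o f))
           (hi : mu.-integrable setT (EFin \o h)) (mA : measurable A).

(** Bracketed so that for fixed [z.1] the factor [f z.1] stands in front as a constant; [mulrCA]
    gives the same shape for fixed [z.2]. *)
Let k (z : T * T) : R := f z.1 * (h z.2 * \1_A z).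

Let mk : measurable_fun setT (EFin \o k).
Proof.
apply/measurable_EFinP; apply: measurable_funM.
  apply: measurableT_comp => //.
  exact/measurable_EFinP/(measurable_int mu).
apply: measurable_funM => //.
apply: measurableT_comp => //.
exact/measurable_EFinP/(measurable_int mu).
Qed.

Let mnorm (l : T -> R) : mu.-integrable setT (EFin \o l) ->
  measurable_fun setT (fun x => `|l x|%:E).
Proof.
move=> li; apply/measurable_EFinP; apply: measurableT_comp => //.
exact/measurable_EFinP/(measurable_int mu).
Qed.

(** Tonelli: the indicator is at most 1, so the iterated integral of [|k|] is at most the product of
    the finite integrals of [|f|] and [|h|]. *)
Let ki : (mu \x mu)%E.-integrable setT (EFin \o k).
Proof.
apply/(integrable12ltyP _ _ mk).
have hfin : (\int[mu]_y `|h y|%:E \is a fin_num)%E.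
  by apply: integrable_fin_num => //; exact: integrable_abse hi.
have h0 : (0 <= \int[mu]_y `|h y|%:E)%E.
  by apply: integral_ge0 => y _; rewrite lee_fin.
apply: (@le_lt_trans _ _ (\int[mu]_x (`|f x|%:E * \int[mu]_y `|h y|%:E))%E).
  apply: ge0_le_integral => //=.
  - by move=> x _; apply: integral_ge0 => y _ /=; rewrite lee_fin.
  - by apply: (measurable_fun_fubini_tonelli_F (abse \o (EFin \o k))) => //=;
      exact: measurableT_comp.
  - by apply: emeasurable_funM => //; exact: mnorm.
  move=> x _; rewrite -ge0_integralZl//=; last exact: mnorm.
  apply: ge0_le_integral => //=.
  - apply/measurable_EFinP; apply: measurableT_comp => //.
    apply: (measurableT_comp (f := k)); first exact/measurable_EFinP.
    exact: pair1_measurable.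
  - by apply: emeasurable_funM => //; exact: mnorm.
  move=> y _; rewrite lee_fin /k/= normrM ler_wpM2l// normrM ler_piMr//.
  by rewrite indicE; case: (_ \in _); rewrite ?normr1 ?normr0.
rewrite -(fineK hfin) ge0_integralZr//=; [|exact: mnorm|exact: fine_ge0].
rewrite lte_mul_pinfty ?lee_fin ?fine_ge0//.
- by apply: integral_ge0 => x _; rewrite lee_fin.
- by apply: integrable_fin_num => //; exact: integrable_abse fi.
- exact: ltry.
Qed.

(** Integrability of [l] makes its integral over [S] finite, so [fine] loses nothing; the
    extended-valued inner integrals of Fubini thus become real ones. *)
Let sectionE (l : T -> R) (S : set T) : mu.-integrable setT (EFin \o l) ->
  measurable S -> forall r,
  (\int[mu]_x (r * (l x * \1_S x))%:E = (r * \int[mu]_(x in S) l x)%:E)%E.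
Proof.
move=> li mS r; have lSi : mu.-integrable setT (EFin \o (l \_ S)).
  rewrite -restrict_EFin; apply: (integrable_mkcond _ mS).1.
  exact: (integrableS measurableT mS _ li).
rewrite Rintegral_mkcond EFinM /Rintegral fineK; last exact: integrable_fin_num.
rewrite -integralZl//.
by apply: eq_integral => x _; rewrite patch_indic EFinM.
Qed.

Let fubini_FE : fubini_F mu (EFin \o k) =
  EFin \o (fun x => f x * \int[mu]_(y in xsection A x) h y).
Proof.
apply/funext => x /=; rewrite -sectionE//; last exact: measurable_xsection.
apply: eq_integral => y _; rewrite /k/= !indicE.
congr (_ * (_ * (nat_of_bool _)%:R))%:E; apply/idP/idP => /[!inE];
  by rewrite /xsection/= ?inE.
Qed.

Let fubini_GE : fubini_G mu (EFin \o k) =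
  EFin \o (fun y => h y * \int[mu]_(x in ysection A y) f x).
Proof.
apply/funext => y /=; rewrite -sectionE//; last exact: measurable_ysection.
apply: eq_integral => x _; rewrite /k/= !indicE mulrCA.
congr (_ * (_ * (nat_of_bool _)%:R))%:E; apply/idP/idP => /[!inE];
  by rewrite /ysection/= ?inE.
Qed.

(** Additivity of [Rintegral] requires integrability, so this accompanies the swap wherever iterated
    integrals are later split. *)
Lemma integrable_Rintegral_section :
  mu.-integrable setT
    (EFin \o (fun x => f x * \int[mu]_(y in xsection A x) h y)).
Proof. by rewrite -fubini_FE; exact: integrable_fubini_F. Qed.

Lemma Rintegral_section_swap :
  \int[mu]_x (f x * \int[mu]_(y in xsection A x) h y) =
  \int[mu]_y (h y * \int[mu]_(x in ysection A y) f x).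
Proof.
have := Fubini ki.
rewrite -/(fubini_F _ _) -/(fubini_G _ _) fubini_FE fubini_GE => E.
by rewrite /Rintegral; congr fine.
Qed.

End fubini_Rintegral.

(* T is only ordered through e. In the application e is the identity, from R
   with the completed sigma-algebra to R with the Borel one. *)
Section Rintegral_order_sections.
Context d (T : measurableType d) (R : realType).
Variable mu : {sigma_finite_measure set T -> \bar R}.
Variables (e : T -> R) (D : set T) (f h : T -> R).
Hypotheses (me : measurable_fun setT e) (mD : measurable D).
Hypotheses (fi : mu.-integrable D (EFin \o f))
           (hi : mu.-integrable D (EFin \o h)).

Let restrict_integrable (l : T -> R) : mu.-integrable D (EFin \o l) ->
  mu.-integrable setT (EFin \o (l \_ D)).
Proof.
by move=> li; rewrite -restrict_EFin; exact: (integrable_mkcond _ mD).1.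
Qed.

Let below := [set z : T * T | e z.2 < e z.1].
Let above := [set z : T * T | e z.2 <= e z.1].

Let mbelow : measurable below.
Proof.
rewrite -[below]setTI.
by apply: (measurable_fun_ltr _ _ measurableT (Y := [set true])) => //;
  exact: measurableT_comp.
Qed.

Let mabove : measurable above.
Proof.
rewrite -[above]setTI.
by apply: (measurable_fun_ler _ _ measurableT (Y := [set true])) => //;
  exact: measurableT_comp.
Qed.

Let xsection_belowE : xsection below = fun x => [set y | e y < e x].
Proof.
by apply/funext => x; apply/seteqP; split => y; rewrite /xsection/= inE.
Qed.

Let ysection_belowE : ysection below = fun y => [set x | e y < e x].
Proof.
by apply/funext => x; apply/seteqP; split => y; rewrite /ysection/= inE.
Qed.

Let xsection_aboveE : xsection above = fun x => [set y | e y <= e x].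
Proof.
by apply/funext => x; apply/seteqP; split => y; rewrite /xsection/= inE.
Qed.

(** Zero extension carries the statements over the whole space back to iterated integrals over
    [D]. *)
Let restrictE (l l' : T -> R) (S : T -> set T) :
  (fun x => (l \_ D) x * \int[mu]_(y in S x) (l' \_ D) y) =
  (fun x => l x * \int[mu]_(y in D `&` S x) l' y) \_ D.
Proof.
apply/funext => x; rewrite [RHS]patchE patchE; case: ifPn; rewrite ?mul0r//.
by rewrite Rintegral_mkcondl.
Qed.

Lemma integrable_ibp_lt : mu.-integrable D
  (EFin \o (fun x => f x * \int[mu]_(y in D `&` [set y | e y < e x]) h y)).
Proof.
apply: (integrable_mkcond _ mD).2.
have := integrable_Rintegral_section (restrict_integrable fi)
  (restrict_integrable hi) mbelow.
by rewrite xsection_belowE restrictE restrict_EFin.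
Qed.

Lemma integrable_ibp_le : mu.-integrable D
  (EFin \o (fun x => f x * \int[mu]_(y in D `&` [set y | e y <= e x]) h y)).
Proof.
apply: (integrable_mkcond _ mD).2.
have := integrable_Rintegral_section (restrict_integrable fi)
  (restrict_integrable hi) mabove.
by rewrite xsection_aboveE restrictE restrict_EFin.
Qed.

Lemma Rintegral_lt_swap :
  \int[mu]_(x in D) (f x * \int[mu]_(y in D `&` [set y | e y < e x]) h y) =
  \int[mu]_(y in D) (h y * \int[mu]_(x in D `&` [set x | e y < e x]) f x).
Proof.
have := Rintegral_section_swap (restrict_integrable fi)
  (restrict_integrable hi) mbelow.
by rewrite xsection_belowE ysection_belowE !restrictE -!Rintegral_mkcond.
Qed.

End Rintegral_order_sections.

(** * Integration by parts over a space ordered through a real map *)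

Section Rintegral_ibp.
Context d (T : measurableType d) (R : realType).
Variable mu : {sigma_finite_measure set T -> \bar R}.
Variables (e : T -> R) (D : set T) (f h : T -> R).
Hypotheses (me : measurable_fun setT e) (mD : measurable D).
Hypotheses (fi : mu.-integrable D (EFin \o f))
           (hi : mu.-integrable D (EFin \o h)).

(** After the swap both terms have outer variable [y], and the inner sets cut [D] in two at [e y],
    so the inner integrals add up to that of [f] over [D]. Points with [e x = e y] must be counted
    once, hence one strict and one weak inequality. *)
Lemma Rintegral_ibp :
  \int[mu]_(x in D) f x * \int[mu]_(y in D) h y =
  \int[mu]_(x in D) (f x * \int[mu]_(y in D `&` [set y | e y < e x]) h y) +
  \int[mu]_(y in D) (h y * \int[mu]_(x in D `&` [set x | e x <= e y]) f x).
Proof.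
have mle y : measurable (D `&` [set x | e x <= e y]).
  exact: measurable_fun_le (measurable_funTS me) _.
have mlt y : measurable (D `&` [set x | e y < e x]).
  rewrite (_ : _ `&` _ = D `\` (D `&` [set x | e x <= e y])).
    exact: measurableD.
  apply/seteqP; split => x /= [Dx].
    by rewrite ltNge => /negP xy; split=> // -[].
  by move/not_andP => -[//|/negP]; rewrite -ltNge.
rewrite Rintegral_lt_swap//.
(* The integral over the strict section is the full one minus that over its complement; the
   subtracted term then cancels the last term of the goal. *)
have -> : \int[mu]_(y in D)
     (h y * \int[mu]_(x in D `&` [set x | e y < e x]) f x) =
   \int[mu]_(y in D) (h y * \int[mu]_(x in D) f x
        - h y * \int[mu]_(x in D `&` [set x | e x <= e y]) f x).
  apply: eq_Rintegral => y _; rewrite -mulrBr; congr (_ * _).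
  apply/eqP; rewrite eq_sym subr_eq -Rintegral_setU//.
  - rewrite -setIUr (_ : _ `|` _ = setT) ?setIT//.
    by rewrite -subTset => x _ /=; case: (leP (e x) (e y)); [right|left].
  - by apply: integrableS fi => //; [exact: measurableU|move=> x [[]|[]]].
  - apply/disj_setPS => x [[_ /= yx] [_ /=]].
    by rewrite leNgt yx.
have hFi : mu.-integrable D (EFin \o (fun y => h y * \int[mu]_(x in D) f x)).
  exact: (integrableZr mD (\int[mu]_(x in D) f x) hi).
rewrite RintegralB//; last exact: integrable_ibp_le.
by rewrite subrK RintegralZr// mulrC.
Qed.

End Rintegral_ibp.

(** * Right limits of integrals *)

(** Dominated convergence with bound [|f|], along sequences tending to [t] from the right. Points
    with [e y = t] lie in every set [e y < v n], hence the weak inequality in the limit. *)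
Lemma cvg_Rintegral_at_right d (T : measurableType d) (R : realType)
    (mu : {measure set T -> \bar R}) (e : T -> R) (D : set T) (f : T -> R)
    (t : R) :
  measurable_fun setT e -> measurable D -> mu.-integrable D (EFin \o f) ->
  \int[mu]_(y in D `&` [set y | e y < x]) f y @[x --> t^'+] -->
  \int[mu]_(y in D `&` [set y | e y <= t]) f y.
Proof.
move=> me mD fi; apply/cvg_at_rightP => v [tv vt].
have mS (S : set R) : measurable S -> measurable (e @^-1` S).
  by move=> mS; rewrite -[X in measurable X]setTI; exact: me.
have mlt x : measurable [set y | e y < x].
  rewrite (_ : [set _ | _] = e @^-1` `]-oo, x[%classic); first exact: mS.
  by apply/seteqP; split => y /=; rewrite in_itv.
have mle : measurable [set y | e y <= t].
  rewrite (_ : [set _ | _] = e @^-1` `]-oo, t]%classic); first exact: mS.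
  by apply/seteqP; split => y /=; rewrite in_itv.
have fSi S : measurable S -> mu.-integrable D (EFin \o (f \_ S)).
  move=> mS'; rewrite -restrict_EFin; apply/integrable_restrict => //.
  by apply: (integrableS mD _ _ fi) => //; exact: measurableI.
(* Zero extension moves the varying set into the integrand, leaving the fixed domain [D]. *)
rewrite Rintegral_mkcondr; under eq_fun do rewrite Rintegral_mkcondr.
apply: fine_cvg; rewrite fineK; last exact: integrable_fin_num (fSi _ mle).
have [||||| _ _] := @dominated_convergence _ _ _ mu D mD
  (fun n => EFin \o (f \_ [set y | e y < v n]))
  (EFin \o (f \_ [set y | e y <= t])) (EFin \o (Num.norm \o f)).
- by move=> n; exact: (measurable_int mu (fSi _ (mlt _))).
- exact: (measurable_int mu (fSi _ mle)).
- apply: aeW => y Dy; apply: cvg_EFin; first by apply: nearW => n.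
  apply: cvg_near_cst; have [yt|ty] := leP (e y) t.
    apply: nearW => n; rewrite /= !patchE mem_set ?mem_set//=.
    exact: le_lt_trans yt (tv n).
  near=> n; have vn : v n < e y by near: n; exact: (cvgr_lt t vt).
  by rewrite /= !patchE !memNset//=; apply/negP; rewrite -?ltNge// -leNgt ltW.
- exact: integrable_norm.
- apply: aeW => y n Dy; rewrite /= lee_fin patchE.
  by case: ifP; rewrite ?normr0.
- exact.
Unshelve. all: by end_near. Qed.

(** * Sigma-finiteness of the Stieltjes measure, required by the product measure *)

Section sigma_finite_stieltjes.
Context (R : realType) (a b : R) (g : derivator a b).

Lemma borel_stieltjes_sigma_finite : sigma_finite setT (borel_stieltjes g).
Proof.
exists (fun n : nat => `[- n%:R, n%:R[%classic); first by rewrite bigcup_itvT.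
move=> n; split; first exact: measurable_itv.
rewrite /borel_stieltjes /pushforward.
have -> : -%R @^-1` `[- n%:R, n%:R[ = `]- n%:R, n%:R]%classic :> set R.
  apply/seteqP; split=> x /=; rewrite !in_itv/= lerN2 ltrNl => /andP[xs xt];
  by rewrite xs xt.
rewrite /lebesgue_stieltjes_measure /measure_extension measurable_mu_extE/=;
  last exact: is_ocitv.
by rewrite wlength_itv_bnd ?ltry// lerNl (le_trans _ (ler0n _ _))// oppr_le0.
Qed.

Lemma stieltjes_sigma_finite : sigma_finite setT (stieltjes g).
Proof.
exact/completed_measure_extension_sigma_finite/borel_stieltjes_sigma_finite.
Qed.

HB.instance Definition _ := Measure_isSigmaFinite.Build _ _ _ (stieltjes g)
  stieltjes_sigma_finite.

End sigma_finite_stieltjes.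

(** * Real-valued Stieltjes integrals over [[a, b[] *)

Section real_stieltjes_integral.
Context (R : realType) (a b : R) (g : derivator a b).
Local Notation mu := (stieltjes g).
Local Notation I := (`[a, b[%classic : set R).

Let T := caratheodory_type (mu_ext (borel_stieltjes g)).

Lemma measurable_stieltjes (S : set R) :
  measurable S -> measurable (S : set T).
Proof.
move=> mS; apply: (@sub_caratheodory _ _ _ (borel_stieltjes g)).
exact: sub_sigma_algebra.
Qed.

Lemma measurable_stieltjes_itv (i : interval R) :
  measurable ([set` i] : set T).
Proof. by apply: measurable_stieltjes; exact: measurable_itv. Qed.

Let mset1 t : measurable ([set t] : set T).
Proof. by apply: measurable_stieltjes; exact: measurable_set1. Qed.

Let mid : measurable_fun setT (idfun : T -> R).
Proof. by move=> _ S mS; rewrite setTI; exact: measurable_stieltjes. Qed.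

Let mI : measurable (I : set T).
Proof. exact: measurable_stieltjes_itv. Qed.

Let I_lt t : a <= t <= b -> I `&` [set y | y < t] = `[a, t[%classic.
Proof.
move=> /andP[_ tb]; apply/seteqP; split => y /=; rewrite !in_itv/=.
  by move=> [/andP[-> _] ->].
by move=> /andP[-> yt]; rewrite yt (lt_le_trans yt tb).
Qed.

(** Here [t < b] is strict because [[a, b]] is not contained in [I]. *)
Let I_le t : a <= t < b -> I `&` [set y | y <= t] = `[a, t]%classic.
Proof.
move=> /andP[_ tb]; apply/seteqP; split => y /=; rewrite !in_itv/=.
  by move=> [/andP[-> _] ->].
by move=> /andP[-> yt]; rewrite yt (le_lt_trans yt tb).
Qed.

(** [p] and [q] are the initial values of the two primitives. Expanding the product leaves two
    linear terms and the product of integrals treated by [Rintegral_ibp]. The integrability clauses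
    serve the complex case, where such integrals are added and subtracted. *)
Lemma stieltjes_ibp (f h : R -> R) (p q : R) :
  mu.-integrable I (EFin \o f) -> mu.-integrable I (EFin \o h) ->
  [/\ mu.-integrable I
        (EFin \o (fun t => (p + \int[mu]_(s in `[a, t[) f s) * h t)),
      mu.-integrable I
        (EFin \o (fun t => f t * (q + \int[mu]_(s in `[a, t]) h s))) &
      (p + \int[mu]_(s in I) f s) * (q + \int[mu]_(s in I) h s) - p * q =
      \int[mu]_(t in I) ((p + \int[mu]_(s in `[a, t[) f s) * h t) +
      \int[mu]_(t in I) (f t * (q + \int[mu]_(s in `[a, t]) h s))].
Proof.
move=> fi hi.
have E1 : {in I, (fun t => p * h t +
     h t * \int[mu]_(s in I `&` [set y | y < t]) f s) =1
   (fun t => (p + \int[mu]_(s in `[a, t[) f s) * h t)}.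
  move=> t; rewrite inE/= in_itv/= => /andP[at_ tb].
  by rewrite I_lt ?at_ ?ltW// mulrDl; congr (_ + _); rewrite mulrC.
have E2 : {in I, (fun t => f t * q +
     f t * \int[mu]_(s in I `&` [set y | y <= t]) h s) =1
   (fun t => f t * (q + \int[mu]_(s in `[a, t]) h s))}.
  move=> t; rewrite inE/= in_itv/= => /andP[at_ tb].
  by rewrite I_le ?at_ ?tb// mulrDr.
have i1 := integrable_ibp_lt mid mI hi fi.
have i2 := integrable_ibp_le mid mI fi hi.
have j1 : mu.-integrable I (EFin \o (fun t => p * h t)).
  exact: (integrableZl mI p hi).
have j2 : mu.-integrable I (EFin \o (fun t => f t * q)).
  exact: (integrableZr mI q fi).
split.
- apply: eq_integrable (integrableD mI j1 i1) => // t tI.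
  by rewrite /= -E1.
- apply: eq_integrable (integrableD mI j2 i2) => // t tI.
  by rewrite /= -E2.
have <- : \int[mu]_(t in I) (p * h t +
      h t * \int[mu]_(s in I `&` [set y | y < t]) f s) =
    \int[mu]_(t in I) ((p + \int[mu]_(s in `[a, t[) f s) * h t).
  exact: eq_Rintegral.
have <- : \int[mu]_(t in I) (f t * q +
      f t * \int[mu]_(s in I `&` [set y | y <= t]) h s) =
    \int[mu]_(t in I) (f t * (q + \int[mu]_(s in `[a, t]) h s)).
  exact: eq_Rintegral.
(* With [h] as the outer function of the first term, the strict sections fall on [f] and the weak
   ones on [h]. *)
have hf := Rintegral_ibp mid mI hi fi; rewrite /= in hf.
rewrite !RintegralD// RintegralZl// RintegralZr//.
rewrite addrACA [_ * q]mulrC -hf; ring.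
Qed.

Lemma cvg_stieltjes_Rintegral_at_right (f : R -> R) t :
  mu.-integrable I (EFin \o f) -> a <= t < b ->
  \int[mu]_(s in `[a, x[) f s @[x --> t^'+] --> \int[mu]_(s in `[a, t]) f s.
Proof.
move=> fi /[dup] tab /andP[ta tb].
rewrite -I_le//; have := cvg_Rintegral_at_right (t := t) mid mI fi.
apply: cvg_trans; apply: near_eq_cvg; near=> x.
rewrite I_lt//; apply/andP; split.
  by rewrite (le_trans ta)//; near: x; exact: nbhs_right_ge.
by near: x; exact: nbhs_right_le.
Unshelve. all: by end_near. Qed.

Let setU_itv1 t : a <= t -> `[a, t]%classic = `[a, t[%classic `|` [set t].
Proof. by move=> at_; rewrite setUitv1. Qed.

Let stieltjes_cst1 (S : set R) : measurable (S : set T) ->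
  \int[mu]_(_ in S) 1 = fine (mu S).
Proof. by move=> mS; rewrite Rintegral_cst// mul1r. Qed.

(** The preceding limit for the constant 1, since [g x] is [g a] plus the mass of [[a, x[]. *)
Lemma cvg_derivator_at_right t : a <= t < b ->
  g x @[x --> t^'+] --> g a + fine (mu `[a, t]).
Proof.
move=> /[dup] tab /andP[ta tb].
have i1 : mu.-integrable I (EFin \o cst 1).
  apply/integrableP; split.
    by apply/measurable_EFinP; exact: measurable_cst.
  under eq_integral do rewrite /= normr1.
  rewrite integral_cst//= mul1e stieltjes_itv ?ltry//.
  by rewrite ltW// (le_lt_trans ta).
have : \int[mu]_(s in `[a, x[) 1 @[x --> t^'+] --> \int[mu]_(s in `[a, t]) 1.
  exact: (cvg_stieltjes_Rintegral_at_right i1 tab).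
have -> : \int[mu]_(s in `[a, t]) 1 = fine (mu `[a, t]).
  by apply: stieltjes_cst1; exact: measurable_stieltjes_itv.
move=> /(cvgD (cvg_cst (g a))); apply: cvg_trans; apply: near_eq_cvg; near=> x.
change (g a + \int[mu]_(s in `[a, x[) 1 = g x).
have -> : \int[mu]_(s in `[a, x[) 1 = fine (mu `[a, x[).
  by apply: stieltjes_cst1; exact: measurable_stieltjes_itv.
rewrite stieltjes_itv//= ?subrKC//.
  by rewrite (le_trans ta)//; near: x; exact: nbhs_right_ge.
by near: x; exact: nbhs_right_le.
Unshelve. all: by end_near. Qed.

(** The right limit of [g] at [t] exceeds [g t] by exactly the mass of [{t}], so a positive mass
    would make [t] a jump point. *)
Lemma stieltjes_set1_eq0 t : a <= t < b -> ~ jump_point g t -> mu [set t] = 0%E.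
Proof.
move=> /[dup] tab /andP[ta tb] gt.
have mt := mset1 t.
have mat := measurable_stieltjes_itv `[a, t[.
(* Finiteness matters because [fine] sends an infinite mass to 0. *)
have mt_fin : mu [set t] \is a fin_num.
  rewrite ge0_fin_numE//; apply: (@le_lt_trans _ _ (mu I)).
    by apply: le_measure; rewrite ?inE// => x ->; rewrite /= in_itv.
  by rewrite stieltjes_itv ?ltry// ltW// (le_lt_trans ta).
apply/eqP; rewrite eq_le measure_ge0 andbT -(fineK mt_fin) lee_fin.
have /cvg_lim gt' := cvg_derivator_at_right tab.
rewrite leNgt; apply/negP => mut; apply: gt; split=> //.
rewrite gt'// setU_itv1// measureU//; last first.
  apply/seteqP; split => // x [/= xt xE].
  by move: xt; rewrite xE in_itv/= ltxx andbF.
rewrite /= stieltjes_itv ?(ltW tb)// -(fineK mt_fin)/=.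
by rewrite addrA subrKC addrAC subrr add0r.
Qed.

Lemma not_jump_point_Rintegral (f : R -> R) t :
  mu.-integrable I (EFin \o f) -> a <= t < b -> ~ jump_point g t ->
  \int[mu]_(s in `[a, t]) f s = \int[mu]_(s in `[a, t[) f s.
Proof.
move=> fi /[dup] tab /andP[ta tb] gt.
have mt := mset1 t.
have mat := measurable_stieltjes_itv `[a, t[.
have fti : mu.-integrable `[a, t] (EFin \o f).
  apply: (integrableS mI _ _ fi); first exact: measurable_stieltjes_itv.
  by move=> x /=; rewrite !in_itv/= => /andP[-> xt]; rewrite (le_lt_trans xt).
rewrite setU_itv1// in fti *; rewrite Rintegral_setU//; last first.
  apply/disj_setPS => x [/= + xt]; rewrite xt in_itv/= ltxx andbF//.
rewrite [X in _ + X]/Rintegral null_set_integral ?addr0//.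
  apply: measurable_int; apply: (integrableS _ mt _ fti).
    exact: measurableU.
  by move=> x; right.
exact: stieltjes_set1_eq0.
Qed.

End real_stieltjes_integral.

(** * From real to arbitrary scalars *)

Lemma cvg_complex (R : realType) T (F : set_system T) (FF : Filter F)
    (p q : T -> R) (r s : R) :
  p @ F --> r -> q @ F --> s ->
  (fun t => Complex (p t) (q t) : scalar_field R ComplexScalars) @ F -->
  (Complex r s : scalar_field R ComplexScalars).
Proof.
move=> pr qs; apply/cvgrPdist_lt => -[e e'].
(* Positivity in [R[i]] forces the imaginary part [e'] to be 0 and leaves a real [e > 0]. *)
rewrite ltcE /= => /andP[/eqP -> e0].
have e20 : 0 < e / 2 by rewrite divr_gt0.
near=> t.
have : `|r - p t| < e / 2.
  by near: t; move/cvgrPdist_lt : pr; apply.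
have : `|s - q t| < e / 2.
  by near: t; move/cvgrPdist_lt : qs; apply.
rewrite !ltr_norml => /andP[s1 s2] /andP[r1 r2].
(* Writing [e] as the square root of [e ^ 2] reduces the goal to squares; coordinates below [e / 2]
   have squares summing to less than [e ^ 2 / 2]. *)
rewrite normc_def /= ltcR -[ltRHS](gtr0_norm e0) -sqrtr_sqr.
rewrite ltr_sqrt ?exprn_gt0//.
nra.
Unshelve. all: by end_near. Qed.

Section stieltjes_primitives.
Context (R : realType) (a b : R) (g : derivator a b) (k : scalar_kind).
Local Notation I := (`[a, b[%classic : set R).
Local Notation integral := (@stieltjes_integral R a b g k).
Local Notation mu := (stieltjes g).
Local Notation Re := complex.Re.
Local Notation Im := complex.Im.
Implicit Types (u phi v w : R -> scalar_field R k) (p q : scalar_field R k).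

Lemma eq_stieltjes_integral (D : set R) v w :
  {in D, v =1 w} -> integral D v = integral D w.
Proof.
move: v w; case: k => v w vw /=; first exact: eq_Rintegral.
by congr Complex; apply: eq_Rintegral => t tD; rewrite vw.
Qed.

Lemma cvg_stieltjes_integral_at_right v t :
  stieltjes_integrable g I v -> a <= t < b ->
  integral `[a, x[ v @[x --> t^'+] --> integral `[a, t] v.
Proof.
move: v; case: k => v /=; first exact: cvg_stieltjes_Rintegral_at_right.
move=> [rv iv] tab; apply: cvg_complex;
  exact: cvg_stieltjes_Rintegral_at_right.
Qed.

Lemma not_jump_point_integral v t :
  stieltjes_integrable g I v -> a <= t < b -> ~ jump_point g t ->
  integral `[a, t] v = integral `[a, t[ v.
Proof.
move: v; case: k => v /=; first exact: not_jump_point_Rintegral.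
by move=> [rv iv] tab gt; congr Complex; exact: not_jump_point_Rintegral.
Qed.

(** One formula for jump and non-jump points alike, matching the weak sections of integration by
    parts. *)
Lemma posterior_traceE u v t : is_stieltjes_derivative g u v -> a <= t < b ->
  posterior_trace g u t = u a + integral `[a, t] v.
Proof.
move=> [vi uv] /[dup] tab /andP[ta tb]; rewrite /posterior_trace.
case: ifPn => [_|/asboolPn gt]; last first.
  rewrite not_jump_point_integral// uv//.
  by rewrite in_itv/= ta ltW.
apply: cvg_lim; first exact: norm_hausdorff.
have := cvg_stieltjes_integral_at_right vi tab.
move=> /(cvgD (cvg_cst (u a))); apply: cvg_trans; apply: near_eq_cvg; near=> x.
(* The representation of [u] is available only on [[a, b]]; [t < b] keeps [x] there near [t]. *)
change (u a + integral `[a, x[ v = u x); rewrite -uv// in_itv/=.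
apply/andP; split.
  by rewrite (le_trans ta)//; near: x; exact: nbhs_right_ge.
by near: x; exact: nbhs_right_le.
Unshelve. all: by end_near. Qed.

(** Complex multiplication mixes coordinates, so the complex case combines four real identities, one
    for each pairing of a coordinate of [v] with one of [w]. *)
Lemma stieltjes_integral_ibp v w p q :
  stieltjes_integrable g I v -> stieltjes_integrable g I w ->
  (p + integral I v) * (q + integral I w) - p * q =
  integral I (fun t => (p + integral `[a, t[ v) * w t) +
  integral I (fun t => v t * (q + integral `[a, t] w)).
Proof.
move: v w p q; case: k => v w p q /=.
  by move=> vi wi; have [] := stieltjes_ibp p q vi wi.
move: p q => [p p'] [q q'] [vi v'i] [wi w'i].
have [i1 j1 E1] := stieltjes_ibp p q vi wi.
have [i2 j2 E2] := stieltjes_ibp p' q' v'i w'i.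
have [i3 j3 E3] := stieltjes_ibp p q' vi w'i.
have [i4 j4 E4] := stieltjes_ibp p' q v'i wi.
have mI : measurable (I : set (caratheodory_type (mu_ext (borel_stieltjes g)))).
  exact: measurable_stieltjes_itv.
apply/eqP; rewrite eq_complex/=; apply/andP; split; apply/eqP.
(* Real part: [E1] minus [E2]. *)
- transitivity (
    (\int[mu]_(t in I) ((p + \int[mu]_(s in `[a, t[) Re (v s)) * Re (w t)) -
     \int[mu]_(t in I) ((p' + \int[mu]_(s in `[a, t[) Im (v s)) * Im (w t))) +
    (\int[mu]_(t in I) (Re (v t) * (q + \int[mu]_(s in `[a, t]) Re (w s))) -
     \int[mu]_(t in I) (Im (v t) * (q' + \int[mu]_(s in `[a, t]) Im (w s))))).
    by rewrite addrACA -opprD -E1 -E2; ring.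
  congr (_ + _); rewrite -RintegralB//; apply: eq_Rintegral => t _.
    by case: (w t).
  by case: (v t).
(* Imaginary part: [E3] plus [E4]. *)
- transitivity (
    (\int[mu]_(t in I) ((p + \int[mu]_(s in `[a, t[) Re (v s)) * Im (w t)) +
     \int[mu]_(t in I) ((p' + \int[mu]_(s in `[a, t[) Im (v s)) * Re (w t))) +
    (\int[mu]_(t in I) (Re (v t) * (q' + \int[mu]_(s in `[a, t]) Im (w s))) +
     \int[mu]_(t in I) (Im (v t) * (q + \int[mu]_(s in `[a, t]) Re (w s))))).
    by rewrite addrACA -E3 -E4; ring.
  congr (_ + _); rewrite -RintegralD//; apply: eq_Rintegral => t _.
    by case: (w t).
  by case: (v t).
Qed.

(** The representations at [b] give the previous identity with [p = u a] and [q = phi a]; its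
    half-open primitive is then [u] and its closed one the posterior trace of [phi]. *)
Lemma stieltjes_derivative_ibp u phi v w :
  is_stieltjes_derivative g u v -> is_stieltjes_derivative g phi w ->
  u b * phi b - u a * phi a =
  integral I (fun t => u t * w t) +
  integral I (fun t => v t * posterior_trace g phi t).
Proof.
move=> uv phiw; have [vi uE] := uv; have [wi phiE] := phiw.
have ab := ltW (derivator_lt g).
rewrite uE ?in_itv/= ?lexx ?ab// phiE ?in_itv/= ?lexx ?ab//.
rewrite stieltjes_integral_ibp//; congr (_ + _);
  apply: eq_stieltjes_integral => t; rewrite inE/= in_itv/= => tab.
  by rewrite (uE t)// in_itv/=; case/andP : tab => -> /ltW ->.
by rewrite (posterior_traceE phiw tab).
Qed.

End stieltjes_primitives.

Theorem theorem3p3 (R : realType) (a b : R) (g : derivator a b)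
    (Mg_gt0 : 0 < g b - g a) (k : scalar_kind)
    (u phi Du Dphi : R -> scalar_field R k)
    (ACu : stieltjes_AC g u) (ACphi : stieltjes_AC g phi)
    (uDu : is_stieltjes_derivative g u Du)
    (phiDphi : is_stieltjes_derivative g phi Dphi) :
  u b * phi b - u a * phi a =
    stieltjes_integral g `[a, b[ (fun t => u t * Dphi t) +
    stieltjes_integral g `[a, b[ (fun t => Du t * posterior_trace g phi t)
  /\
  u b * phi b - u a * phi a =
    stieltjes_integral g `[a, b[ (fun t => posterior_trace g u t * Dphi t) +
    stieltjes_integral g `[a, b[ (fun t => Du t * phi t).
Proof.
split; first exact: stieltjes_derivative_ibp.
rewrite mulrC [u a * _]mulrC (stieltjes_derivative_ibp phiDphi uDu) addrC.
by congr (_ + _); apply: eq_stieltjes_integral => t _; exact: mulrC.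
Qed.
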